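(* Let $k$ be a field. The category $\mathbf{PostLie}_k$ of post-Lie algebras over $k$ is not action accessible. That is, there exist a post-Lie algebra $X$ over $k$ and a split extension of post-Lie algebras with kernel $X$ which admits no morphism in $\mathrm{Split}(X)$ into a faithful object of $\mathrm{Split}(X)$.
   Context: A post-Lie algebra over a field $k$ is a $k$-vector space $A$ with two bilinear maps $\{\cdot,\cdot\}:A\times A\to A$ and $\cdot:A\times A\to A$ (written $xy$) such that $(A,\{\cdot,\cdot\})$ is a Lie algebra and, for all $x,y,z\in A$, $$x\{y,z\}=\{xy,z\}+\{y,xz\},\qquad \{x,y\}z=a(x,y,z)-a(y,x,z),$$ where $a(x,y,z):=x(yz)-(xy)z$. Morphisms in $\mathbf{PostLie}_k$ are $k$-linear maps preserving both operations. It is a semi-abelian variety with zero object $\{0\}$. Let $\mathcal{C}$ be a semi-abelian category and $X$ an object of $\mathcal{C}$. A split extension with kernel $X$ is a diagram $X\xrightarrow{\mu}E\xrightarrow{p}A$ in $\mathcal{C}$ together with a morphism $s:A\to E$ such that $\mu$ is a kernel of $p$ and $p s=\mathrm{id}_A$; it is denoted $(A,E,p,s,\mu)$. The category $\mathrm{Split}(X)$ has these split extensions (with arbitrary $A$ and $E$) as objects; a morphism $(A,E,p,s,\mu)\to(A',E',p',s',\mu')$ is a pair of morphisms $f:E\to E'$, $g:A\to A'$ in $\mathcal{C}$ with $f\mu=\mu'$, $p'f=gp$ and $fs=s'g$. An object $\Sigma$ of $\mathrm{Split}(X)$ is faithful if every object of $\mathrm{Split}(X)$ admits at most one morphism into $\Sigma$.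 An object is accessible if it admits a morphism into some faithful object. The category $\mathcal{C}$ is action accessible if, for every object $X$ of $\mathcal{C}$, every object of $\mathrm{Split}(X)$ is accessible. *)

(* Defs.v *)
From HB Require Import structures.
From mathcomp Require Import all_boot all_algebra boolp.

Set Implicit Arguments.
Unset Strict Implicit.
Unset Printing Implicit Defensive.
Import GRing.Theory.
Local Open Scope ring_scope.

Record category := Category {
  ob :> Type;
  hom : ob -> ob -> Type;
  idm : forall A, hom A A;
  compm : forall A B D, hom B D -> hom A B -> hom A D;
  compIm : forall A B (f : hom A B), compm (idm B) f = f;
  compmI : forall A B (f : hom A B), compm f (idm A) = f;
  compmA : forall A B D E (h : hom D E) (g : hom B D) (f : hom A B),
    compm h (compm g f) = compm (compm h g) f
}.

Arguments hom {c} A B.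
Arguments idm {c} A.
Arguments compm {c A B D} g f : rename.

Record pointed_category := PointedCategory {
  pcat :> category;
  zero_ob : pcat;
  to_zero : forall A : pcat, hom A zero_ob;
  from_zero : forall A : pcat, hom zero_ob A;
  to_zero_uniq : forall (A : pcat) (f : hom A zero_ob), f = to_zero A;
  from_zero_uniq : forall (A : pcat) (f : hom zero_ob A), f = from_zero A
}.

Arguments zero_ob {p}.
Arguments to_zero {p} A.
Arguments from_zero {p} A.

Definition zerom (C : pointed_category) (A B : C) : hom A B :=
  compm (from_zero B) (to_zero A).

Definition is_kernel (C : pointed_category) (X E A : C)
    (mu : hom X E) (p : hom E A) : Prop :=
  compm p mu = zerom X A /\
  forall (Z : C) (f : hom Z E), compm p f = zerom Z A ->
    exists! g : hom Z X, compm mu g = f.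

(* Split extensions and action accessibility only involve kernels, so they are
   set up for every category with a zero object, semi-abelian or not. *)
Record split_ext (C : pointed_category) (X : C) := SplitExt {
  se_quo : C;
  se_tot : C;
  se_p : hom se_tot se_quo;
  se_s : hom se_quo se_tot;
  se_mu : hom X se_tot;
  se_kernel : is_kernel se_mu se_p;
  se_split : compm se_p se_s = idm se_quo
}.

Record split_mor (C : pointed_category) (X : C) (S T : split_ext X) :=
  SplitMor {
    sm_tot : hom (se_tot S) (se_tot T);
    sm_quo : hom (se_quo S) (se_quo T);
    sm_mu : compm sm_tot (se_mu S) = se_mu T;
    sm_p : compm (se_p T) sm_tot = compm sm_quo (se_p S);
    sm_s : compm sm_tot (se_s S) = compm (se_s T) sm_quo
  }.

Section SplitCategory.
Variables (C : pointed_category) (X : C).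

Lemma split_mor_eq (S T : split_ext X) (u v : split_mor S T) :
  sm_tot u = sm_tot v -> sm_quo u = sm_quo v -> u = v.
Proof.
case: u v => [f g e1 e2 e3] [f' g' e1' e2' e3'] /= ef eg.
by subst f' g'; f_equal; apply: Prop_irrelevance.
Qed.

Definition split_id (S : split_ext X) : split_mor S S.
Proof.
by exists (idm _) (idm _); rewrite ?compIm ?compmI.
Defined.

Definition split_comp (S T U : split_ext X)
  (v : split_mor T U) (u : split_mor S T) : split_mor S U.
Proof.
exists (compm (sm_tot v) (sm_tot u)) (compm (sm_quo v) (sm_quo u)).
- by rewrite -compmA !sm_mu.
- by rewrite compmA sm_p -compmA sm_p compmA.
- by rewrite -compmA sm_s compmA sm_s compmA.
Defined.

Definition split_cat : category.
Proof.
apply: (@Category (split_ext X) (@split_mor C X) split_id split_comp).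
- by move=> S T u; apply: split_mor_eq; rewrite /= compIm.
- by move=> S T u; apply: split_mor_eq; rewrite /= compmI.
- by move=> S T U V w v u; apply: split_mor_eq; rewrite /= compmA.
Defined.

Definition faithful (S : split_cat) : Prop :=
  forall (T : split_cat) (u v : hom T S), u = v.

Definition accessible (S : split_cat) : Prop :=
  exists T : split_cat, faithful T /\ inhabited (hom S T).

End SplitCategory.

Definition action_accessible (C : pointed_category) : Prop :=
  forall (X : C) (S : split_cat X), accessible S.

Definition associator (A : zmodType) (m : A -> A -> A) (x y z : A) : A :=
  m x (m y z) - m (m x y) z.

(* The bracket is required to be alternating, which in characteristic 2 is
   stronger than being antisymmetric. *)
HB.mixin Record isPostLie (k : fieldType) A of GRing.Lmodule k A := {
  plbr : A -> A -> A;
  plmul : A -> A -> A;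
  plbr_linearr : forall x : A, linear (plbr x);
  plbr_linearl : forall y : A, linear (plbr^~ y);
  plmul_linearr : forall x : A, linear (plmul x);
  plmul_linearl : forall y : A, linear (plmul^~ y);
  plbrxx : forall x : A, plbr x x = 0;
  pl_jacobi : forall x y z : A,
    plbr x (plbr y z) + plbr y (plbr z x) + plbr z (plbr x y) = 0;
  plmul_br : forall x y z : A,
    plmul x (plbr y z) = plbr (plmul x y) z + plbr y (plmul x z);
  plbr_mul : forall x y z : A,
    plmul (plbr x y) z = associator plmul x y z - associator plmul y x z
}.

#[short(type="postLieType")]
HB.structure Definition PostLie (k : fieldType) :=
  {A of isPostLie k A & GRing.Lmodule k A}.

Record postlie_hom (k : fieldType) (A B : postLieType k) := PostLieHom {
  plfun :> {linear A -> B};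
  plfun_br : {morph plfun : x y / plbr x y};
  plfun_mul : {morph plfun : x y / plmul x y}
}.

Section PostLieCategory.
Variable k : fieldType.

Lemma postlie_hom_eq (A B : postLieType k) (f g : postlie_hom A B) :
  f =1 g -> f = g.
Proof.
case: f g => [f f1 f2] [g g1 g2] /= fg.
have efg : f = g.
  case: f g fg {f1 f2 g1 g2} => [f [[?] [?]]] [g [[?] [?]]] /= /funext efg.
  by subst g; do !f_equal; apply: Prop_irrelevance.
by subst g; f_equal; apply: Prop_irrelevance.
Qed.

Definition postlie_id (A : postLieType k) : postlie_hom A A :=
  @PostLieHom k A A idfun (fun _ _ => erefl) (fun _ _ => erefl).

Definition postlie_comp (A B D : postLieType k)
  (g : postlie_hom B D) (f : postlie_hom A B) : postlie_hom A D.
Proof.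
exists (g \o f : {linear A -> D}) => x y /=.
- by rewrite !plfun_br.
- by rewrite !plfun_mul.
Defined.

Definition PostLie_cat : category.
Proof.
apply: (@Category (postLieType k) (@postlie_hom k) postlie_id postlie_comp);
  by move=> *; apply: postlie_hom_eq.
Defined.

Lemma rV0_eq (x y : 'rV[k]_0) : x = y.
Proof. by rewrite [x]thinmx0 [y]thinmx0. Qed.

Definition postlie0_mixin := @isPostLie.Build k 'rV[k]_0
  (fun _ _ => 0) (fun _ _ => 0)
  (fun _ _ _ _ => rV0_eq _ _) (fun _ _ _ _ => rV0_eq _ _)
  (fun _ _ _ _ => rV0_eq _ _) (fun _ _ _ _ => rV0_eq _ _)
  (fun _ => rV0_eq _ _) (fun _ _ _ => rV0_eq _ _)
  (fun _ _ _ => rV0_eq _ _) (fun _ _ _ => rV0_eq _ _).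

Definition postlie0 : postLieType k := HB.pack 'rV[k]_0 postlie0_mixin.

Lemma plbr0r (A : postLieType k) (x : A) : plbr x 0 = 0.
Proof. by have := plbr_linearr x (-1) 0 0; rewrite scaler0 addr0 scaleN1r addNr. Qed.

Lemma plmul0r (A : postLieType k) (x : A) : plmul x 0 = 0.
Proof. by have := plmul_linearr x (-1) 0 0; rewrite scaler0 addr0 scaleN1r addNr. Qed.

Definition postlie_null (A B : postLieType k) : postlie_hom A B.
Proof.
exists (\0 : {linear A -> B}) => x y /=.
- by rewrite plbr0r.
- by rewrite plmul0r.
Defined.

Definition PostLie_pcat : pointed_category.
Proof.
apply: (@PointedCategory PostLie_cat postlie0
  (fun A => postlie_null A _) (fun A => postlie_null _ A)) => A f.
- by apply: postlie_hom_eq => x; apply: rV0_eq.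
- by apply: postlie_hom_eq => x; rewrite (rV0_eq x 0) !linear0.
Defined.

End PostLieCategory.

(* Main.v *)
From HB Require Import structures.
Require Import Defs.
From mathcomp Require Import all_boot all_algebra.
From mathcomp Require Import ring.

(** If [S -> T] is a morphism of split extensions of [X] with [T] faithful, then
    every subalgebra [B] of the quotient of [S] which acts trivially on [X] is
    killed: the composite [B -> S -> T] and the zero map are two morphisms into
    [T] from the product extension [X * B].  Hence so is the ideal generated by
    [B], which must therefore also act trivially on [X].  For pre-Lie algebras
    (post-Lie algebras with zero bracket) this can fail, because only the
    commutator [ab - ba], and not the product [ab], has its left action
    determined by those of [a] and [b].  Take for the quotient the commutative
    algebra with basis [a, b, c] and only nonzero products [ab = ba = c], acting
    on the line [X = k] with zero product by [cx = x] and all other actions zero;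
    [B] is the line spanned by [a]. *)

Set Implicit Arguments.
Unset Strict Implicit.
Unset Printing Implicit Defensive.
Import GRing.Theory.
Local Open Scope ring_scope.

Lemma plmul0l (k : fieldType) (A : postLieType k) (x : A) : plmul 0 x = 0.
Proof.
by have := plmul_linearl x (-1) 0 0; rewrite scaler0 addr0 scaleN1r addNr.
Qed.

Lemma postlie_hom_app (k : fieldType) (A B : postLieType k)
  (f g : postlie_hom A B) : f = g -> f =1 g.
Proof. by move=> ->. Qed.

(** * Pre-Lie algebras as post-Lie algebras *)

Record prelie_mul (k : fieldType) (A : lmodType k) := PreLieMul {
  prmul :> A -> A -> A;
  prmul_linearr : forall x, linear (prmul x);
  prmul_linearl : forall y, linear (prmul^~ y);
  prmul_leftsym : forall x y z,
    associator prmul x y z = associator prmul y x z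
}.

Section PreLie.
Variables (k : fieldType) (A : lmodType k) (m : prelie_mul A).

Lemma prmul0l x : m 0 x = 0.
Proof.
by have := prmul_linearl m x (-1) 0 0; rewrite scaler0 addr0 scaleN1r addNr.
Qed.

Lemma prmul0r x : m x 0 = 0.
Proof.
by have := prmul_linearr m x (-1) 0 0; rewrite scaler0 addr0 scaleN1r addNr.
Qed.

Lemma prmulZl c x y : m (c *: x) y = c *: m x y.
Proof. by have := prmul_linearl m y c x 0; rewrite prmul0l !addr0. Qed.

Lemma prmulZr c x y : m x (c *: y) = c *: m x y.
Proof. by have := prmul_linearr m x c y 0; rewrite prmul0r !addr0. Qed.

(** With zero bracket, the axioms involving the bracket collapse to the left symmetry of the
    associator. *)
Definition prelie_mixin : isPostLie k A.
Proof.
apply: (@isPostLie.Build k A (fun _ _ => 0) m _ _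
  (prmul_linearr m) (prmul_linearl m)).
- by move=> x a u v; rewrite scaler0 addr0.
- by move=> y a u v; rewrite scaler0 addr0.
- by [].
- by move=> x y z; rewrite !addr0.
- by move=> x y z; rewrite prmul0r addr0.
- by move=> x y z; rewrite prmul0l prmul_leftsym subrr.
Defined.

Definition prelie : postLieType k :=
  HB.pack (GRing.Lmodule.sort A) prelie_mixin.

Lemma prelie_mulE (x y : prelie) : plmul x y = m x y.
Proof. by []. Qed.

End PreLie.

Definition prelie_hom (k : fieldType) (A B : lmodType k)
    (m : prelie_mul A) (n : prelie_mul B) (f : {linear A -> B})
    (fM : {morph f : x y / m x y >-> n x y}) :
  postlie_hom (prelie m) (prelie n).
Proof.
exists (f : {linear prelie m -> prelie n}) => // x y.
exact: (linear0 f).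
Defined.

Definition null_mul (k : fieldType) (A : lmodType k) : prelie_mul A.
Proof.
by exists (fun _ _ => 0) => [x a u v|y a u v|//]; rewrite scaler0 addr0.
Defined.

Section LinearMaps.
Variables (k : fieldType) (X A : lmodType k).

Definition pairl (x : X) : (X * A)%type := (x, 0).
Definition pairr (a : A) : (X * A)%type := (0, a).
Definition line (a : A) (c : k^o) : A := (c : k) *: a.
Definition pair_line (a : A) (u : (X * k^o)%type) : (X * A)%type :=
  (u.1, line a u.2).

Lemma pairl_is_linear : linear pairl.
Proof. by move=> c x y; congr pair; rewrite /= scaler0 addr0. Qed.

Lemma pairr_is_linear : linear pairr.
Proof. by move=> c x y; congr pair; rewrite /= scaler0 addr0. Qed.

Lemma line_is_linear (a : A) : linear (line a).
Proof. by move=> c x y; rewrite /line scalerDl scalerA. Qed.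

Lemma pair_line_is_linear a : linear (pair_line a).
Proof. by move=> c u v; congr pair; apply: line_is_linear. Qed.

HB.instance Definition _ :=
  GRing.isLinear.Build k X (X * A)%type _ pairl pairl_is_linear.
HB.instance Definition _ :=
  GRing.isLinear.Build k A (X * A)%type _ pairr pairr_is_linear.
HB.instance Definition _ a :=
  GRing.isLinear.Build k k^o A _ (line a) (line_is_linear a).
HB.instance Definition _ a :=
  GRing.isLinear.Build k (X * k^o)%type (X * A)%type _ (pair_line a)
    (pair_line_is_linear a).

End LinearMaps.

(** * Split extensions given by a scalar left action *)

Section Semidirect.
Variables (k : fieldType) (X A : lmodType k) (m : prelie_mul A).
Variable l : {scalar A}.
Hypothesis lC : forall a b, l (m a b) = l (m b a).

(** [A] acts on the left of [X] through [l]; the right action and the product of [X] are zero. The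
    associator of [a], [b] in [A] and [x] in [X] is [(l a * l b - l (m a b)) *: x], symmetric in [a]
    and [b] by [lC]. *)
Definition semidirect_mul : prelie_mul (X * A)%type.
Proof.
exists (fun u v => (l u.2 *: v.1, m u.2 v.2)).
- move=> u a v w; congr pair => /=; last exact: prmul_linearr.
  by rewrite scalerDr !scalerA mulrC.
- move=> w a u v; congr pair => /=; last exact: prmul_linearl.
  by rewrite linearP scalerDl scalerA.
- move=> u v w; congr pair => /=; last exact: prmul_leftsym.
  by rewrite !scalerA lC mulrC.
Defined.

Definition semidirect_in :
  postlie_hom (prelie (null_mul X)) (prelie semidirect_mul).
Proof.
apply: (@prelie_hom k X (X * A)%type _ semidirect_mul (@pairl k X A)).
by move=> x y; rewrite /= /pairl (linear0 l) scale0r prmul0l.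
Defined.

Definition semidirect_pr : postlie_hom (prelie semidirect_mul) (prelie m).
Proof. by apply: (@prelie_hom _ _ _ _ _ (@snd X A)). Defined.

Definition semidirect_sec : postlie_hom (prelie m) (prelie semidirect_mul).
Proof.
apply: (@prelie_hom k A (X * A)%type m semidirect_mul (@pairr k X A)) => x y.
by rewrite /= scaler0.
Defined.

End Semidirect.

Section SemidirectExt.
Variables (k : fieldType) (X A : lmodType k) (m : prelie_mul A).
Variable l : {scalar A}.
Hypothesis lC : forall a b, l (m a b) = l (m b a).

Lemma semidirect_kernel :
  @is_kernel (PostLie_pcat k) _ _ _ (semidirect_in X lC) (semidirect_pr X lC).
Proof.
split; first exact: (@postlie_hom_eq k (prelie (null_mul X)) (prelie m)).
move=> Z f pf.
have f2 z : (f z).2 = 0 by have /= := postlie_hom_app pf z.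
have lin1 : linear (fun z : Z => (f z).1) by move=> a x y; rewrite linearP.
pose g : {linear Z -> prelie (null_mul X)} :=
  HB.pack (fun z : Z => (f z).1) (GRing.isLinear.Build _ _ _ _ _ lin1).
have gbr : {morph g : x y / plbr x y} by move=> x y; rewrite /= plfun_br.
have gmul : {morph g : x y / plmul x y}.
  (* The acting scalar [l (f x).2] vanishes because [f] lands in the kernel. *)
  by move=> x y; rewrite /= plfun_mul /= f2 linear0 scale0r.
exists (PostLieHom gbr gmul); split.
  apply: (@postlie_hom_eq k Z (prelie _)) => z.
  by rewrite /= /pairl -(f2 z); case: (f z).
by move=> h hf; apply: postlie_hom_eq => z /=; rewrite -hf.
Qed.

Lemma semidirect_split :
  @compm (PostLie_pcat k) _ _ _ (semidirect_pr X lC) (semidirect_sec X lC)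
    = idm _.
Proof. exact: (@postlie_hom_eq k (prelie m) (prelie m)). Qed.

Definition semidirect_ext :
  @split_cat (PostLie_pcat k) (prelie (null_mul X)) :=
  SplitExt semidirect_kernel semidirect_split.

End SemidirectExt.

(** * The obstruction to accessibility *)

Section NotAccessible.
Variables (k : fieldType) (X A : lmodType k) (m : prelie_mul A).
Variable l : {scalar A}.
Hypothesis lC : forall a b, l (m a b) = l (m b a).
Variables (a b : A) (x : X).
(** By [maa] the line spanned by [a] is a subalgebra with zero product, by [la] it acts trivially on
    [X], and by [lab] the ideal it generates does not. *)
Hypotheses (la : l a = 0) (maa : m a a = 0) (lab : l (m a b) != 0).
Hypothesis x_neq0 : x != 0.

Let null_lC (c d : k^o) :
  (\0 : {scalar k^o}) (null_mul k^o c d) =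
  (\0 : {scalar k^o}) (null_mul k^o d c).
Proof. by []. Qed.

(** The zero form on the null line makes this the product extension of [X] by that line. *)
Let prod_ext := semidirect_ext X null_lC.

Definition line_quo : postlie_hom (prelie (null_mul k^o)) (prelie m).
Proof.
apply: (@prelie_hom k k^o A _ _ (line a)) => c d.
by rewrite linear0 /line prmulZl prmulZr maa !scaler0.
Defined.

Definition line_tot :
  postlie_hom (prelie (semidirect_mul X null_lC))
              (prelie (semidirect_mul X lC)).
Proof.
apply: (@prelie_hom k (X * k^o)%type (X * A)%type _ _ (@pair_line k X A a)).
move=> u v; congr pair => /=.
  by rewrite /line linearZ /= la mulr0 !scale0r.
by rewrite linear0 /line prmulZl prmulZr maa !scaler0.
Defined.

Definition line_mor : Defs.hom prod_ext (semidirect_ext X lC).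
Proof.
apply: (@SplitMor (PostLie_pcat k) (prelie (null_mul X)) prod_ext
  (semidirect_ext X lC) line_tot line_quo); apply: postlie_hom_eq => y /=.
- by rewrite /pair_line /line /= scale0r.
- by [].
- by [].
Defined.

Definition prod_pr :
  postlie_hom (prelie (semidirect_mul X null_lC)) (prelie (null_mul X)).
Proof.
by apply: (@prelie_hom k (X * k^o)%type X _ _ (@fst X k^o)) => u v;
  rewrite /= scale0r.
Defined.

(** In a product the projection onto [X] is a morphism, so it can be followed by the kernel map of
    any [T]. *)
Definition null_mor (T : split_ext (prelie (null_mul X) : PostLie_pcat k)) :
  split_mor prod_ext T.
Proof.
apply: (@SplitMor (PostLie_pcat k) (prelie (null_mul X)) prod_ext T
  (compm (se_mu T) prod_pr) (zerom _ _)); apply: postlie_hom_eq => y /=.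
- by [].
- exact: (postlie_hom_app (proj1 (se_kernel T))).
- by rewrite !linear0.
Defined.

Lemma semidirect_not_accessible : ~ accessible (semidirect_ext X lC).
Proof.
case=> T [faithT [w]].
have e : @compm (split_cat _) _ _ _ w line_mor = null_mor T by apply: faithT.
pose E' : postLieType k := se_tot T.
pose F : postlie_hom (prelie (semidirect_mul X lC)) E' := sm_tot w.
pose mu : postlie_hom (prelie (null_mul X)) E' := se_mu T.
have etot : postlie_comp F line_tot = postlie_comp mu prod_pr.
  exact: (congr1 (fun h : split_mor prod_ext T => sm_tot h) e).
have Fa : F (0, a) = 0.
  (* The element [(0, 1)] goes to [(0, a)] under [line_tot] and to zero under [prod_pr]. *)
  have /= := postlie_hom_app etot (0, 1).
  by rewrite /pair_line /line /= scale1r linear0.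
have Fab : F (0, m a b) = 0.
  have := plfun_mul F (0, a) (0, b).
  by rewrite Fa plmul0l prelie_mulE /= scaler0.
have mu0 y : mu y = 0.
  have Fy : F (y, 0) = mu y.
    exact: (postlie_hom_app (sm_mu w)).
  (* The inverse scalar makes this product equal to [(y, 0)]. *)
  have := plfun_mul F (0, m a b) ((l (m a b))^-1 *: y, 0).
  by rewrite Fab plmul0l prelie_mulE /= prmul0r scalerA divff // scale1r Fy.
have [muZ kerT] := se_kernel T.
(* As [mu] vanishes, the identity and the zero map of [X] both factor [mu] through itself;
   uniqueness then forces [X] to be zero. *)
have [g [_ g_uniq]] := kerT _ (se_mu T) muZ.
have g_id := g_uniq (idm _) (compmI _).
have g_zero : g = zerom _ _.
  apply: g_uniq; apply: postlie_hom_eq => y /=.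
  by rewrite linear0; apply/esym/mu0.
have /= x0 := postlie_hom_app (etrans (esym g_id) g_zero) x.
by case/eqP: x_neq0.
Qed.

End NotAccessible.

Section Counterexample.
Variable k : fieldType.

Let A := (k^o * k^o * k^o)%type.

Definition abc_mul : prelie_mul A.
Proof.
exists (fun u v => (0, 0, (u.1.1 : k) * v.1.2 + (u.1.2 : k) * v.1.1)).
- move=> u c v w; congr (_, _, _);
    by rewrite /= ?scaler0 ?addr0 // /GRing.scale /=; ring.
- move=> w c u v; congr (_, _, _);
    by rewrite /= ?scaler0 ?addr0 // /GRing.scale /=; ring.
(* All triple products vanish. *)
- by move=> u v w; rewrite /associator /= !mulr0 !mul0r.
Defined.

(** The coordinate along [c], so that only [c] acts, and by the scalar 1. *)
Definition abc_form (u : A) : k := u.2.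

Lemma abc_form_is_scalar : scalar abc_form.
Proof. by []. Qed.

HB.instance Definition _ :=
  GRing.isLinear.Build k A k *%R abc_form abc_form_is_scalar.

Lemma abc_formC u v : abc_form (abc_mul u v) = abc_form (abc_mul v u).
Proof. by rewrite /abc_form /= addrC mulrC [X in _ + X]mulrC. Qed.

Lemma abc_not_accessible : ~ accessible (semidirect_ext k^o abc_formC).
Proof.
apply: (@semidirect_not_accessible k k^o A abc_mul abc_form abc_formC
  (1, 0, 0) (0, 1, 0) 1) => //=.
- by rewrite mulr0 mul0r addr0.
- by rewrite /abc_form /= mulr1 mulr0 addr0 oner_neq0.
- exact: oner_neq0.
Qed.

End Counterexample.

Theorem proposition3p5 (k : fieldType) :
  ~ action_accessible (PostLie_pcat k) /\
  (exists (X : PostLie_pcat k) (S : split_cat X), ~ accessible S).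
Proof.
split; last first.
  by exists _, (semidirect_ext k^o (@abc_formC k)); apply: abc_not_accessible.
by move=> /(_ _ (semidirect_ext k^o (@abc_formC k))); apply: abc_not_accessible.
Qed.
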